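(* Let $g(n,k)$ denote the number of unit Fubini rankings of length $n$ with exactly $n-k$ distinct values (with the convention $g(0,0)=1$ and $g(0,k)=0$ for $k\ge1$). Then, as formal power series, $$G(x,q)=\sum_{n\ge 0}\sum_{k\ge 0} g(n,k)\,q^k\frac{x^n}{n!}=\frac{1}{1-x-\frac{q}{2}x^2}.$$
   Context: $[n]=\{1,\ldots,n\}$. Parking process: $\alpha=(a_1,\ldots,a_n)\in[n]^n$ encodes preferences of cars $1,\ldots,n$ arriving in order at a one-way street with spots $1,\ldots,n$; car $i$ parks in spot $a_i$ if free, otherwise in the first free spot after $a_i$, if any. $\alpha$ is a parking function if all cars park. A unit interval parking function is a parking function in which each car $i$ parks in spot $a_i$ or $a_i+1$. A Fubini ranking is a tuple $(r_1,\ldots,r_n)\in[n]^n$ with $r_i=1+|\{j:r_j<r_i\}|$ for all $i$. A unit Fubini ranking is a tuple that is both a Fubini ranking and a unit interval parking function. *)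

(* Defs.v *)
From HB Require Import structures.
From mathcomp Require Import all_boot all_order all_algebra.
From mathcomp Require Import boolp.

Set Implicit Arguments.
Unset Strict Implicit.
Unset Printing Implicit Defensive.

Import GRing.Theory.

(** * Parking functions and Fubini rankings

   Spots and ranks are elements of ['I_n]: the ordinal of value [i] stands for
   the number [i.+1] of the set {1, ..., n}.  An element of [n]^n is thus an
   [n.-tuple 'I_n], cars and positions being indexed by ['I_n] as well. *)

Section Parking.
Variable n : nat.
Implicit Types (occ : seq 'I_n) (a : 'I_n) (s : seq 'I_n) (t : n.-tuple 'I_n).

(* [occ] is the list of occupied spots; [enum 'I_n] is increasing, so that
   [ohead] returns the first free spot after [a], if any. *)
Definition park_car occ a : option 'I_n :=
  if a \notin occ then Some a
  else ohead [seq p : 'I_n <- enum 'I_n | (a < p) && (p \notin occ)].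

(* Spots obtained by successive cars with preferences [s]; a car that cannot
   park gets [None] and leaves the street unchanged. *)
Fixpoint park_from occ s : seq (option 'I_n) :=
  if s is a :: s' then
    let p := park_car occ a in
    p :: park_from (if p is Some b then b :: occ else occ) s'
  else [::].

Definition outcome t : seq (option 'I_n) := park_from [::] t.

Definition car_spot t (i : 'I_n) : option 'I_n := nth None (outcome t) i.

Definition parking_function t : bool := [forall i, isSome (car_spot t i)].

Definition unit_interval_parking_function t : bool :=
  parking_function t &&
  [forall i, if car_spot t i is Some p
             then (p == tnth t i :> nat) || (p == (tnth t i).+1 :> nat)
             else false].

Definition fubini_ranking t : bool :=
  [forall i, (tnth t i).+1 == 1 + #|[set j | tnth t j < tnth t i]|].

Definition unit_fubini_ranking t : bool :=
  fubini_ranking t && unit_interval_parking_function t.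

Definition num_distinct t : nat := #|[set tnth t i | i : 'I_n]|.

End Parking.

(* The condition [num_distinct t + k == n] says that there are [n - k] distinct
   values with [n - k] computed in the integers; in particular no tuple is
   counted when [n < k]. *)
Definition num_unit_fubini (n k : nat) : nat :=
  #|[set t : n.-tuple 'I_n | unit_fubini_ranking t & num_distinct t + k == n]|.

Lemma num_unit_fubini0 k : num_unit_fubini 0 k = (k == 0).
Proof.
rewrite /num_unit_fubini; have nd0 (t : 0.-tuple 'I_0) : num_distinct t = 0.
  by apply/eqP; rewrite cards_eq0; apply/eqP/setP=> -[].
case: k => [|k] /=; last first.
  by apply/eqP; rewrite cards_eq0; apply/eqP/setP=> t; rewrite !inE nd0 andbF.
rewrite -[RHS](cards1 ([tuple] : 0.-tuple 'I_0)); congr #|pred_of_set _|.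
apply/setP=> t; rewrite !inE nd0 [t]tuple0 andbT [RHS]eqxx.
rewrite /unit_fubini_ranking /unit_interval_parking_function
  /fubini_ranking /parking_function.
by apply/and3P; split; apply/forallP => -[].
Qed.

(** * Formal power series *)

Local Open Scope ring_scope.

Record fps (R : Type) := Fps { fcoef : nat -> R }.

Lemma fpsP (R : Type) (f g : fps R) : fcoef f =1 fcoef g <-> f = g.
Proof. by split=> [|->//]; case: f g => [f] [g] /= /funext ->. Qed.

HB.instance Definition _ (R : Type) := gen_eqMixin (fps R).
HB.instance Definition _ (R : Type) := gen_choiceMixin (fps R).

Section FpsRing.
Variable R : comNzRingType.
Implicit Types f g h : fps R.

Definition fps_zero : fps R := Fps (fun=> 0).
Definition fps_opp f : fps R := Fps (fun n => - fcoef f n).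
Definition fps_add f g : fps R := Fps (fun n => fcoef f n + fcoef g n).

Definition fpsC (c : R) : fps R := Fps (fun n => c *+ (n == 0%N)).
Definition fpsX : fps R := Fps (fun n => (n == 1%N)%:R).

Definition fps_mul f g : fps R :=
  Fps (fun n => \sum_(i < n.+1) fcoef f i * fcoef g (n - i)%N).

Fact fps_addA : associative fps_add.
Proof. by move=> f g h; apply/fpsP=> n /=; rewrite addrA. Qed.

Fact fps_addC : commutative fps_add.
Proof. by move=> f g; apply/fpsP=> n /=; rewrite addrC. Qed.

Fact fps_add0 : left_id fps_zero fps_add.
Proof. by move=> f; apply/fpsP=> n /=; rewrite add0r. Qed.

Fact fps_addN : left_inverse fps_zero fps_opp fps_add.
Proof. by move=> f; apply/fpsP=> n /=; rewrite addNr. Qed.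

HB.instance Definition _ :=
  GRing.isZmodule.Build (fps R) fps_addA fps_addC fps_add0 fps_addN.

Let trunc N f : {poly R} := \poly_(i < N) fcoef f i.

Let fps_mulE N f g n : (n < N)%N ->
  fcoef (fps_mul f g) n = (trunc N f * trunc N g)`_n.
Proof.
move=> ltnN; rewrite coefM /=; apply: eq_bigr => i _; rewrite !coef_poly.
by rewrite (leq_ltn_trans _ ltnN) 1?(leq_ltn_trans _ ltnN) ?leq_subr // -ltnS.
Qed.

Fact fps_mulC : commutative fps_mul.
Proof. by move=> f g; apply/fpsP=> n; rewrite !(@fps_mulE n.+1) // mulrC. Qed.

Fact fps_mulA : associative fps_mul.
Proof.
move=> f g h; apply/fpsP=> n.
transitivity (trunc n.+1 f * (trunc n.+1 g * trunc n.+1 h))`_n.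
  rewrite coefM; apply: eq_bigr => i _.
  by rewrite -(@fps_mulE n.+1 g h) ?ltnS ?leq_subr // coef_poly ltn_ord.
rewrite mulrA coefM; apply: eq_bigr => i _.
by rewrite -(@fps_mulE n.+1 f g) ?ltn_ord // coef_poly ltnS leq_subr.
Qed.

Fact fps_mul1 : left_id (fpsC 1) fps_mul.
Proof.
move=> f; apply/fpsP=> n /=; rewrite big_ord_recl /= mul1r subn0 big1 ?addr0 //.
by move=> i _; rewrite mul0r.
Qed.

Fact fps_mulDl : left_distributive fps_mul fps_add.
Proof.
move=> f g h; apply/fpsP=> n /=; rewrite -big_split /=.
by apply: eq_bigr => i _; rewrite mulrDl.
Qed.

Fact fps_1neq0 : fpsC 1 != 0.
Proof. by apply/eqP=> /fpsP/(_ 0%N)/eqP /=; rewrite oner_eq0. Qed.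

HB.instance Definition _ := GRing.Zmodule_isComNzRing.Build (fps R)
  fps_mulA fps_mulC fps_mul1 fps_mulDl fps_1neq0.

(* As in every [unitRingType], the inverse of a non-unit is itself. *)
Definition fps_unit : {pred fps R} := fun f => `[< exists g, g * f = 1 >].

Definition fps_inv f : fps R :=
  if pselect (exists g, g * f = 1) is left fU then projT1 (cid fU) else f.

Fact fps_mulVf : {in fps_unit, left_inverse 1 fps_inv *%R}.
Proof.
by move=> f /asboolP fU; rewrite /fps_inv; case: pselect => // ?; case: cid.
Qed.

Fact fps_unitPl f g : g * f = 1 -> fps_unit f.
Proof. by move=> gf1; apply/asboolP; exists g. Qed.

Fact fps_inv_out : {in [predC fps_unit], fps_inv =1 id}.
Proof. by move=> f /asboolP nfU; rewrite /fps_inv; case: pselect. Qed.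

HB.instance Definition _ := GRing.ComNzRing_hasMulInverse.Build (fps R)
  fps_mulVf fps_unitPl fps_inv_out.

End FpsRing.

Arguments fpsX {R}.

(** * The generating function

   Series in [x] and [q] over the rationals form the ring Q[[q]][[x]]:
   the coefficient of [q^k x^n] in [f] is [fcoef (fcoef f n) k]. *)

Notation qxseries := (fps (fps rat)).

Definition xvar : qxseries := fpsX.
Definition qvar : qxseries := fpsC fpsX.

Definition unit_fubini_gf : qxseries :=
  Fps (fun n => Fps (fun k => (num_unit_fubini n k)%:R / (n`!)%:R)).

(* Main.v *)
Require Import Defs.
From mathcomp Require Import all_boot all_order all_algebra.
From mathcomp Require Import zify.

(* In a Fubini ranking the [m] cars of rank [a] park, in order of arrival, in the
   spots [a, ..., a + m - 1]; hence the ranking is a unit interval parking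
   function iff every rank is shared by at most two cars.  Deleting the cars of
   largest rank (one or two of them) leaves a ranking of the same kind with one
   value less, and Pascal's rule turns this recursion into
   [2 ^ k * g (d + k, k) = (d + k)! * 'C(d, k)].  So the coefficient of [q^k x^n]
   is ['C(n - k, k) / 2 ^ k], which Pascal's rule shows to be that of
   [1 / (1 - x - q x^2 / 2)]. *)

Set Implicit Arguments.
Unset Strict Implicit.
Unset Printing Implicit Defensive.

Import GRing.Theory.

(** * Sorted enumerations and multiplicities in sequences *)

Lemma ohead_filter_enum_ord n (P : pred 'I_n) (p : 'I_n) :
  P p -> (forall q : 'I_n, q < p -> ~~ P q) ->
  ohead [seq q <- enum 'I_n | P q] = Some p.
Proof.
move=> Pp minp; have : p \in [seq q <- enum 'I_n | P q].
  by rewrite mem_filter Pp mem_enum.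
have : sorted (relpre val ltn) [seq q <- enum 'I_n | P q].
  apply: sorted_filter; first by move=> ? ? ?; apply: ltn_trans.
  by rewrite -sorted_map val_enum_ord iota_ltn_sorted.
have /= := filter_all P (enum 'I_n).
case: [seq q <- _ | _] => //= q s /andP[Pq _] ps.
rewrite inE => /predU1P[-> //|psP].
have /allP/(_ p psP) /= ltqp := order_path_min (fun _ _ _ => @ltn_trans _ _ _) ps.
by rewrite (negPf (minp q ltqp)) in Pq.
Qed.

Lemma count_mem_tuple (n : nat) (T : eqType) (t : n.-tuple T) a :
  count_mem a t = #|[set i | tnth t i == a]|.
Proof.
rewrite -{1}(map_tnth_enum t) count_map cardsE cardE /enum_mem size_filter
  -enumT.
by rewrite (eq_filter (a2 := predT)) ?filter_predT.
Qed.

(** The last occurrence of a value has all the other occurrences before it. With [m = 1] this turns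
    the unit condition on parking into a bound on multiplicities. *)
Lemma count_mem_take_leq (T : eqType) (x0 : T) m (s : seq T) :
  (forall i, i < size s -> count_mem (nth x0 s i) (take i s) <= m) <->
  (forall a, count_mem a s <= m.+1).
Proof.
split=> [|le_s i lt_i]; last first.
  rewrite -ltnS; apply: leq_trans (le_s (nth x0 s i)).
  rewrite -{4}(cat_take_drop i.+1 s) (take_nth x0) // count_cat -cats1 count_cat.
  by rewrite /= eqxx; lia.
elim/last_ind: s => [//|s x IHs] le_s a.
have le_sx : count_mem x s <= m.
  have := le_s (size s); rewrite size_rcons nth_rcons ltnn eqxx => /(_ (ltnSn _)).
  by rewrite -cats1 take_size_cat.
rewrite -cats1 count_cat /= addn0; case: eqP => [<-|_]; first by rewrite addn1.
rewrite addn0; apply: IHs => i lt_i.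
have := le_s i; rewrite size_rcons nth_rcons lt_i => /(_ (ltnW lt_i)).
by rewrite -cats1 (takel_cat _ (ltnW lt_i)).
Qed.

Lemma count_mem_cat_cons (T : eqType) (u v : seq T) a b :
  count_mem b (u ++ a :: v) = count_mem b u + (a == b) + count_mem b v.
Proof. by rewrite count_cat addnA. Qed.

Lemma count_mem_gt0 (T : eqType) (s : seq T) a : (0 < count_mem a s) = (a \in s).
Proof. by rewrite -has_count has_pred1. Qed.

(** * How the cars of a Fubini ranking park *)

Section FubiniParking.
Variable n : nat.
Implicit Types (occ s u v : seq 'I_n) (t : n.-tuple 'I_n) (a b p : 'I_n).

(** The block of [a] is the interval of [count_mem a s] spots starting at [a]. Plain sequences are
    used so that [s] can be cut into cars already parked and cars still to come. *)
Definition block_disjoint s :=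
  (forall a, a + count_mem a s <= n) /\
  (forall a b, b \in s -> a < b -> a + count_mem a s <= b).

(** Invariant of the parking process: once the cars [u] have parked, each block is filled from its
    left end without gaps. *)
Definition blocks_occupied occ u :=
  forall p, reflect (exists2 a : 'I_n, a \in u & a <= p < a + count_mem a u)
                    (p \in occ).

(** The spots of the block of [a] before this one are all taken, and this one is free because it
    lies in no other block. *)
Lemma park_car_block occ u a v :
  block_disjoint (u ++ a :: v) -> blocks_occupied occ u ->
  exists2 p : 'I_n, park_car occ a = Some p & p = a + count_mem a u :> nat.
Proof.
move=> [disj_n disj] occP.
have ltpn : a + count_mem a u < n.
  by have := disj_n a; rewrite count_mem_cat_cons eqxx; lia.
have free (p : 'I_n) : p = a + count_mem a u :> nat -> p \notin occ.
  (* A parked preference [b] covering [p] would make its block meet that of [a] if [b] differs from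
     [a]; if they agree, [p] lies just past the filled part. *)
  move=> pE; apply/negP => /occP[b bu /andP[lebp ltpb]].
  case: (ltngtP a b) => [ltab|ltba|/val_inj eqab].
  - have := disj a b; rewrite mem_cat bu count_mem_cat_cons eqxx.
    by move=> /(_ isT ltab); lia.
  - have := disj b a; rewrite mem_cat inE eqxx orbT count_mem_cat_cons.
    by move=> /(_ isT ltba); lia.
  - by subst b; lia.
exists (Ordinal ltpn) => //; rewrite /park_car.
(* If [a] is free, the invariant shows that no earlier car prefers [a], so the offset is 0. *)
case: ifPn => [aF|/negPn/occP aO].
  congr Some; apply: val_inj => /=; have : a \notin u.
    apply: contra aF => au; apply/occP; exists a => //.
    by rewrite leqnn -{1}[val a]addn0 ltn_add2l count_mem_gt0.
  by move/count_memPn => ->; rewrite addn0.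
have aO' : a \in occ by apply/occP.
apply: ohead_filter_enum_ord => [|q ltqp].
  rewrite free // andbT /= ltn_neqAle leq_addr andbT.
  apply: contraTneq aO' => /esym eqa; exact: free.
have {}ltqp : q < a + count_mem a u := ltqp.
rewrite negb_and negbK; case: ltnP => //= ltaq; apply/occP; exists a; last by lia.
by rewrite -count_mem_gt0; lia.
Qed.

Lemma blocks_occupied_rcons occ u a p :
  p = a + count_mem a u :> nat -> blocks_occupied occ u ->
  blocks_occupied (p :: occ) (u ++ [:: a]).
Proof.
move=> pE occP q; rewrite inE; apply: (iffP orP) => [[/eqP->|/occP[b bu qb]]|].
- by exists a; rewrite ?mem_cat ?mem_head ?orbT // count_mem_cat_cons eqxx; lia.
- by exists b; rewrite ?mem_cat ?bu // count_mem_cat_cons; lia.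
move=> [b]; rewrite mem_cat inE count_mem_cat_cons addn0 => bua bq.
have [eqqp|neqqp] := eqVneq q p; [by left | right; apply/occP].
have {}neqqp : q <> p :> nat by move/val_inj/eqP; rewrite (negPf neqqp).
exists b; last first.
  by case: (eqVneq a b) bq => [ab|_]; rewrite ?ab in pE *; lia.
case/orP: bua => [//|/eqP eqba]; subst b; rewrite -count_mem_gt0.
by move: bq; rewrite eqxx; lia.
Qed.

(** Induction on the cars [v] still to come; [u] and [occ] are general because each step moves one
    car from [v] to [u]. *)
Lemma park_from_blocks occ u v i b0 :
  block_disjoint (u ++ v) -> blocks_occupied occ u -> i < size v ->
  exists2 p : 'I_n, nth None (park_from occ v) i = Some p &
    p = nth b0 v i + count_mem (nth b0 v i) (u ++ take i v) :> nat.
Proof.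
elim: v occ u i => [//|a v IHv] occ u i disj occP lt_i.
have [p eqp pE] := park_car_block disj occP.
case: i lt_i => [|i] /= lt_i; first by exists p; rewrite ?cats0.
rewrite eqp; have [||//|q eqq qE] := IHv (p :: occ) (u ++ [:: a]) i.
- by rewrite -catA.
- exact: blocks_occupied_rcons.
by exists q; rewrite // qE -catA.
Qed.

Lemma fubini_rankingP t :
  reflect (forall i, tnth t i = #|[set j | tnth t j < tnth t i]| :> nat)
          (fubini_ranking t).
Proof.
apply: (iffP forallP) => rk i; first by have /eqP[] := rk i.
by rewrite add1n eqSS; apply/eqP.
Qed.

(** For a rank [a] that occurs, [a + count_mem a t] counts the cars of rank at most [a]. These are
    at most [n], and all of them rank below any later rank [b], whose value is the number of such
    cars. *)
Lemma fubini_block_disjoint t : fubini_ranking t -> block_disjoint t.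
Proof.
move=> /fubini_rankingP rk.
have cardU a : a \in t -> a + count_mem a t = #|[set j | tnth t j <= a]|.
  move=> /tnthP[i ->]; rewrite {1}rk count_mem_tuple -cardsUI.
  rewrite (_ : _ :&: _ = set0) ?cards0 ?addn0; last first.
    apply/setP=> j; rewrite !inE.
    by case: (eqVneq (tnth t j)) => [->|]; rewrite ?ltnn ?andbF.
  congr #|pred_of_set _|; apply/setP=> j.
  by rewrite !inE -val_eqE /= orbC -leq_eqVlt.
split=> [a|a b /tnthP[i ->] ltab].
  have [at_|/count_memPn->] := boolP (a \in t); last by rewrite addn0 ltnW.
  by rewrite cardU // -[X in _ <= X](card_ord n) max_card.
have [at_|/count_memPn->] := boolP (a \in t); last by rewrite addn0 ltnW.
rewrite cardU // [X in _ <= X]rk; apply/subset_leq_card/subsetP => j.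
by rewrite !inE => /leq_ltn_trans; apply.
Qed.

Lemma car_spot_fubini t i : fubini_ranking t ->
  exists2 p : 'I_n, car_spot t i = Some p &
    p = tnth t i + count_mem (tnth t i) (take i t) :> nat.
Proof.
move=> /fubini_block_disjoint disj.
have occ0 : blocks_occupied [::] [::] by move=> p; constructor=> -[].
have := @park_from_blocks [::] [::] t i (tnth t i) disj occ0.
rewrite size_tuple /car_spot /outcome => /(_ (ltn_ord i)) [p -> pE].
by exists p => //; rewrite pE -tnth_nth.
Qed.

(** The displacement of a car is the number of earlier cars of its rank, so the unit condition
    allows at most one of them. *)
Lemma unit_fubini_rankingE t :
  unit_fubini_ranking t = fubini_ranking t &&
    [forall i, #|[set j | tnth t j == tnth t i]| <= 2].
Proof.
apply: andb_id2l => Ft.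
have -> : unit_interval_parking_function t =
          [forall i : 'I_n, count_mem (tnth t i) (take i t) <= 1].
  apply/andP/forallP => [[_ /forallP unit_t] i|le1].
    have := unit_t i; have [p -> ->] := car_spot_fubini i Ft.
    by case/orP => /eqP; lia.
  split; apply/forallP => i; have [p -> //pE] := car_spot_fubini i Ft.
  by rewrite pE; have := le1 i; lia.
have cnt_take (x0 : 'I_n) := count_mem_take_leq x0 1 t.
apply/forallP/forallP => [le1 i|le2 i].
  rewrite -count_mem_tuple; apply: (cnt_take i).1 => j.
  rewrite size_tuple => lt_j.
  by have := le1 (Ordinal lt_j); rewrite (tnth_nth i).
rewrite (tnth_nth i); apply: (cnt_take i).2; last by rewrite size_tuple.
move=> a; have [/tnthP[j ->]|/count_memPn-> //] := boolP (a \in t).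
by rewrite count_mem_tuple.
Qed.

End FubiniParking.

(** * Removal of the cars of largest rank, and the resulting count *)

Section TopBlock.
Variables (T : finType) (M : nat).
Implicit Types (A B : {set T}) (r : {ffun T -> 'I_M.+1}).

(* The ranking is [r] restricted to [A]; the value [0] outside [A] makes [r]
   unique, so that rankings of all subsets live in one type. *)
Definition small_rankings A d := [set r : {ffun T -> 'I_M.+1} |
  [&& [forall i in A, (r i == #|[set j in A | r j < r i]| :> nat) &&
                      (#|[set j in A | r j == r i]| <= 2)],
      [forall i in ~: A, r i == ord0] &
      #|r @: A| == d]].

Definition top_block A r := [set i in A | [forall j in A, r j <= r i]].

(** With [m = ord0] the same operation erases the block [B]. *)
Definition add_top B (m : 'I_M.+1) r := [ffun i => if i \in B then m else r i].

Lemma small_rankingsP A d r :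
  reflect [/\ {in A, forall i, r i = #|[set j in A | r j < r i]| :> nat},
              {in A, forall i, #|[set j in A | r j == r i]| <= 2},
              {in ~: A, forall i, r i = ord0} & #|r @: A| = d]
          (r \in small_rankings A d).
Proof.
rewrite inE; apply: (iffP and3P) => [[/forall_inP rk /forall_inP r0 /eqP dE]|].
  split=> // i iA; first by have /andP[/eqP] := rk i iA.
    by have /andP[] := rk i iA.
  exact/eqP/r0.
move=> [rk le2 r0 ->]; split=> //; apply/forall_inP => i iA.
  by rewrite -rk // eqxx le2.
by rewrite r0.
Qed.

(** Cars of [B] have exactly [A :\: B] below them, hence the value of [m]; every other car keeps its
    lower and equal cars. The equality of booleans serves both to add and to remove a top block. *)
Lemma add_top_ranking A B d r (m : 'I_M.+1) :
  B \subset A -> B != set0 -> m = #|A :\: B| :> nat ->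
  {in B, forall i, r i = ord0} ->
  {in A :\: B, forall i, r i < m} ->
  (#|B| <= 2) && (r \in small_rankings (A :\: B) d) =
  (add_top B m r \in small_rankings A d.+1) && (top_block A (add_top B m r) == B).
Proof.
move=> sBA /set0Pn[b0 b0B] mE r0 ltm; set R := add_top B m r.
have RB i : i \in B -> R i = m by move=> iB; rewrite ffunE iB.
have RC i : i \notin B -> R i = r i by move=> iB; rewrite ffunE (negPf iB).
have ltm' i : i \in A -> i \notin B -> r i < m.
  by move=> iA iB; rewrite ltm // inE iA iB.
have -> : top_block A R = B.
  apply/setP=> i; rewrite inE; apply/andP/idP => [[iA /forall_inP topi]|iB].
    apply: contraT => iB; have := topi b0 (subsetP sBA _ b0B).
    by rewrite RB // RC // leqNgt ltm'.
  split; first exact: (subsetP sBA).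
  apply/forall_inP => j jA; rewrite (RB i) //.
  by have [/RB->//|jB] := boolP (j \in B); rewrite RC // ltnW ?ltm'.
have lowB i : i \in B -> [set j in A | R j < R i] = A :\: B.
  move=> iB; apply/setP=> j; rewrite !inE (RB i) // andbC.
  have [/RB->|jB] := boolP (j \in B); first by rewrite ltnn.
  by rewrite RC //; case: (boolP (j \in A)) => jA; rewrite ?andbF ?andbT ?ltm'.
have lowC i : i \in A -> i \notin B ->
    [set j in A | R j < R i] = [set j in A :\: B | r j < r i].
  move=> iA iB; apply/setP=> j; rewrite !inE (RC i) //.
  have [/RB->|jB] := boolP (j \in B); last by rewrite RC.
  by rewrite ltnNge ltnW ?andbF ?ltm'.
have eqB i : i \in B -> [set j in A | R j == R i] = B.
  move=> iB; apply/setP=> j; rewrite inE (RB i) //.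
  have [jB|jB] := boolP (j \in B); first by rewrite RB // eqxx (subsetP sBA).
  rewrite RC //; case: (boolP (j \in A)) => //= jA.
  by apply/negbTE; rewrite -val_eqE neq_ltn ltm'.
have eqC i : i \in A -> i \notin B ->
    [set j in A | R j == R i] = [set j in A :\: B | r j == r i].
  move=> iA iB; apply/setP=> j; rewrite !inE (RC i) //.
  have [/RB->|jB] := boolP (j \in B); last by rewrite RC.
  by rewrite [m == _]negbTE ?andbF // -val_eqE neq_ltn ltm' ?orbT.
have imR : R @: A = m |: r @: (A :\: B).
  apply/setP=> v; apply/imsetP/setU1P => [[i iA ->]|[->|/imsetP[i]]].
  - have [/RB->|iB] := boolP (i \in B); [by left | right].
    by rewrite RC //; apply/imsetP; exists i; rewrite // inE iB.
  - by exists b0; rewrite ?RB // (subsetP sBA).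
  - by rewrite inE => /andP[iB iA] ->; exists i; rewrite ?RC.
(* All old ranks are below [m], so [m] is a new value. *)
have cardR : #|R @: A| = #|r @: (A :\: B)|.+1.
  rewrite imR cardsU1; case: imsetP => // -[i iAB mi].
  by have := ltm i iAB; rewrite -mi ltnn.
rewrite eqxx andbT; apply/andP/small_rankingsP; rewrite cardR.
  case=> leB /small_rankingsP[rk le2 rk0 ->]; split=> // i.
  - have [iB _|iB iA] := boolP (i \in B); first by rewrite lowB // RB.
    by rewrite lowC // (RC i) //; apply: rk; rewrite inE iB.
  - have [iB _|iB iA] := boolP (i \in B); first by rewrite eqB.
    by rewrite eqC //; apply: le2; rewrite inE iB.
  rewrite inE => iA; have iB : i \notin B.
    by apply: contra iA; apply: (subsetP sBA).
  by rewrite (RC i) //; apply: rk0; rewrite !inE (negPf iA) andbF.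
case=> rk le2 rk0 [dE].
have leB : #|B| <= 2 by rewrite -(eqB _ b0B) le2 // (subsetP sBA).
split=> //; apply/small_rankingsP; split=> // i; rewrite !inE.
- by case/andP=> iB iA; rewrite -lowC // -(RC i) //; apply: rk.
- by case/andP=> iB iA; rewrite -eqC //; apply: le2.
rewrite negb_and negbK; have [/r0//|iB /= iA] := boolP (i \in B).
by rewrite -(RC i) //; apply: rk0; rewrite inE.
Qed.

Lemma top_block_low A r i : {in A, forall j, r j <= r i} -> i \in A ->
  [set j in A | r j < r i] = A :\: top_block A r.
Proof.
move=> topi iA; apply/setP=> j; rewrite !inE andbC.
case: (boolP (j \in A)) => jA; rewrite ?andbF ?andbT //=.
apply/idP/negP => [ltji /forall_inP topj|ntop].
  by have := topj i iA; rewrite leqNgt ltji.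
rewrite ltnNge; apply/negP => leij; apply: ntop.
apply/forall_inP => l lA.
exact: leq_trans (topi l lA) leij.
Qed.

Lemma top_blockP A r i :
  reflect (i \in A /\ {in A, forall j, r j <= r i}) (i \in top_block A r).
Proof. by rewrite inE; apply: (iffP andP) => -[iA /forall_inP]. Qed.

Lemma ranking_top A d r i : r \in small_rankings A d -> i \in top_block A r ->
  r i = #|A :\: top_block A r| :> nat.
Proof.
case/small_rankingsP=> rk _ _ _ /top_blockP[iA topi].
by rewrite -(top_block_low topi iA) -rk.
Qed.

(** A car is not ranked below itself. This gives the bound on old ranks under which a top block can
    be added. *)
Lemma ranking_lt_card A d r i : r \in small_rankings A d -> i \in A ->
  r i < #|A|.
Proof.
case/small_rankingsP=> rk _ _ _ iA; rewrite rk //; apply/proper_card/properP.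
split; first by apply/subsetP=> j; rewrite inE => /andP[].
by exists i; rewrite // inE ltnn andbF.
Qed.

(** A positive number of values forces a car to exist, and the top cars all share one rank, whose
    multiplicity is at most two. *)
Lemma top_block_small A d r : r \in small_rankings A d.+1 ->
  [&& top_block A r \subset A, top_block A r != set0 & #|top_block A r| <= 2].
Proof.
move=> rA; have sTA : top_block A r \subset A.
  by apply/subsetP=> i /top_blockP[].
have [i0 i0A] : exists i, i \in A.
  apply/set0Pn; apply: contraTneq rA => ->; apply/small_rankingsP => -[_ _ _].
  by rewrite imset0 cards0.
have [i iA topi] := arg_maxnP (fun i => r i : nat) i0A.
have iT : i \in top_block A r by apply/top_blockP.
have nT0 : top_block A r != set0 by apply/set0Pn; exists i.
rewrite sTA nT0 /=; case/small_rankingsP: (rA) => _ le2 _ _.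
apply: leq_trans (le2 i iA); apply/subset_leq_card/subsetP => j jT.
rewrite inE (subsetP sTA) //; apply/eqP/val_inj.
by rewrite /= (ranking_top rA iT) (ranking_top rA jT).
Qed.

(** Adding [B] as top block is a bijection; its inverse resets the ranks on [B] to 0. *)
Lemma card_small_rankings_top A B d :
  #|A| <= M.+1 -> B \subset A -> B != set0 -> #|B| <= 2 ->
  #|[set r in small_rankings A d.+1 | top_block A r == B]| =
  #|small_rankings (A :\: B) d|.
Proof.
move=> leAM sBA nB0 leB.
(* Since [B] is nonempty, the new rank fits in ['I_M.+1]. *)
have ltM : #|A :\: B| < M.+1.
  apply: leq_trans leAM; rewrite cardsD (setIidPr sBA).
  by move: nB0 (subset_leq_card sBA); rewrite -card_gt0; lia.
pose m := Ordinal ltM.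
(* Injectivity holds because the overwritten values on [B] were all 0. *)
rewrite -[RHS](card_in_imset (f := add_top B m)); last first.
  move=> r1 r2 /small_rankingsP[_ _ r10 _] /small_rankingsP[_ _ r20 _] /ffunP eqr.
  apply/ffunP=> i; have := eqr i; rewrite !ffunE.
  by case: ifP => // iB _; rewrite r10 ?r20 // !inE iB.
apply: eq_card => r; rewrite inE.
apply/idP/imsetP => [/andP[rA /eqP topB]|[r' r'A ->]].
  have rE : r = add_top B m (add_top B ord0 r).
    apply/ffunP=> i; rewrite !ffunE; case: ifP => [iB|->] //.
    by apply: val_inj; rewrite /= -topB (ranking_top rA) ?topB.
  exists (add_top B ord0 r); last exact: rE.
  suff /andP[] : (#|B| <= 2) &&
      (add_top B ord0 r \in small_rankings (A :\: B) d) by [].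
  rewrite (@add_top_ranking _ _ _ _ m) -?rE ?rA ?topB //= => i; last first.
    rewrite inE => /andP[iB iA]; rewrite ffunE (negPf iB) /=.
    have /set0Pn[b bB] := nB0; rewrite -topB -(ranking_top rA (i := b)) ?topB //.
    move: (bB); rewrite -topB => /top_blockP[bA topb].
    have : i \in [set j in A | r j < r b].
      by rewrite top_block_low // topB inE iB.
    by rewrite inE => /andP[].
  by move=> iB; rewrite ffunE iB.
rewrite -add_top_ranking ?leB //.
- by move=> i iB; case/small_rankingsP: r'A => _ _ -> //; rewrite !inE iB.
- by move=> i; apply: ranking_lt_card r'A.
Qed.

Lemma card_small_rankingsS A d : #|A| <= M.+1 ->
  #|small_rankings A d.+1| =
  \sum_(B : {set T} | (B \subset A) && (#|B| == 1)) #|small_rankings (A :\: B) d| +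
  \sum_(B : {set T} | (B \subset A) && (#|B| == 2)) #|small_rankings (A :\: B) d|.
Proof.
move=> leAM; rewrite -sum1_card.
rewrite (partition_big (top_block A)
  (fun B => [&& B \subset A, B != set0 & #|B| <= 2])) => [|r]; last first.
  exact: top_block_small.
rewrite (bigID (fun B => #|B| == 1)) /=; congr (_ + _).
all: apply: eq_big => [B|B /andP[/and3P[sBA nB0 leB] _]].
- case: (B \subset A) => //=; rewrite -card_gt0; lia.
- by rewrite -(card_small_rankings_top d leAM sBA nB0 leB) sum1dep_card.
- case: (B \subset A) => //=; rewrite -card_gt0; lia.
- by rewrite -(card_small_rankings_top d leAM sBA nB0 leB) sum1dep_card.
Qed.

Lemma small_rankings_eq0 A d : #|A| < d -> #|small_rankings A d| = 0.
Proof.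
move=> ltAd; apply/eqP; rewrite cards_eq0; apply/eqP/setP=> r; rewrite in_set0.
apply/small_rankingsP => -[_ _ _ dE].
by have := leq_imset_card r A; rewrite dE leqNgt ltAd.
Qed.

Lemma small_rankings0 : small_rankings set0 0 = [set [ffun=> ord0]].
Proof.
apply/setP=> r; rewrite inE; apply/small_rankingsP/eqP => [[_ _ r0 _]|->].
  by apply/ffunP=> i; rewrite ffunE r0 // !inE.
by split=> [i|i|i|]; rewrite ?inE // ?ffunE // imset0 cards0.
Qed.

(** Induction on [d] through the top block: one car leaves the parameters [(d, k)], two cars leave
    [(d, k - 1)], and Pascal's rule adds the two contributions. The factor [2 ^ k] keeps the
    identity in the naturals. *)
Lemma card_small_rankings A d k : #|A| <= M.+1 -> #|A| = d + k ->
  #|small_rankings A d| * 2 ^ k = (d + k)`! * 'C(d, k).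
Proof.
elim: d A k => [|d IHd] A k leAM cA.
  have [A0|nA0] := eqVneq A set0.
    move: cA; rewrite A0 cards0 add0n => <-.
    by rewrite small_rankings0 cards1.
  (* A nonempty set of cars has no ranking with zero values, and ['C(0, k)] vanishes for positive
     [k]. *)
  have k_gt0 : 0 < k by move: nA0; rewrite -card_gt0 cA.
  rewrite bin0n eqn0Ngt k_gt0 muln0; apply/eqP; rewrite muln_eq0 cards_eq0.
  apply/orP; left; apply/eqP/setP=> r; rewrite in_set0.
  apply/small_rankingsP => -[_ _ _ /eqP].
  by rewrite cards_eq0 imset_eq0 (negPf nA0).
have cD (B : {set T}) : B \subset A -> #|A :\: B| = #|A| - #|B|.
  by move=> sBA; rewrite cardsD (setIidPr sBA).
rewrite card_small_rankingsS // mulnDl.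
have -> : (\sum_(B : {set T} | (B \subset A) && (#|B| == 1))
    #|small_rankings (A :\: B) d|) * 2 ^ k = (d.+1 + k)`! * 'C(d, k).
  rewrite big_distrl /= (eq_bigr (fun=> (d + k)`! * 'C(d, k))); last first.
    move=> B /andP[sBA /eqP cB]; apply: IHd; rewrite cD ?cB //; lia.
  by rewrite sum_nat_cond_const cards_draws bin1 cA mulnA addSn factS.
case: k cA => [|k] cA.
  (* With [k = 0], removing two of the [d.+1] cars leaves fewer than [d]; [leA] excludes [d = 0],
     where the subtraction would truncate. *)
  rewrite !bin0 [X in _ + X * _]big1 ?mul0n ?addn0 // => B /andP[sBA /eqP cB].
  have := subset_leq_card sBA; rewrite cA cB => leA.
  by rewrite small_rankings_eq0 // cD // cB cA; lia.
have -> : (\sum_(B : {set T} | (B \subset A) && (#|B| == 2))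
    #|small_rankings (A :\: B) d|) * 2 ^ k.+1 = (d.+1 + k.+1)`! * 'C(d, k).
  (* One factor 2 of [2 ^ k.+1] is set apart: for [n = #|A|], multiplying by it and by ['C(n, 2)]
     turns [(n - 2)!] into [n!]. *)
  rewrite big_distrl /= (eq_bigr (fun=> 2 * ((d + k)`! * 'C(d, k)))); last first.
    move=> B /andP[sBA /eqP cB]; rewrite expnS mulnCA IHd ?cD ?cB //; lia.
  rewrite sum_nat_cond_const cards_draws cA !mulnA; congr (_ * _).
  by rewrite -(@bin_fact (d.+1 + k.+1) 2) ?addnS // mulnA; congr (_ * _`!); lia.
by rewrite -mulnDr -binS.
Qed.

End TopBlock.

(** * The numbers of unit Fubini rankings *)

Lemma num_unit_fubini_gt n k : n < k -> num_unit_fubini n k = 0.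
Proof.
move=> ltnk; apply/eqP; rewrite cards_eq0; apply/eqP/setP=> t.
by rewrite !inE; apply/negbTE; rewrite negb_and; apply/orP; right; lia.
Qed.

Lemma num_unit_fubiniE d k :
  num_unit_fubini (d + k) k * 2 ^ k = (d + k)`! * 'C(d, k).
Proof.
(* Ranks in [small_rankings] live in some ['I_M.+1], so length 0 is treated apart. *)
case E: (d + k) => [|n].
  move/eqP: E; rewrite addn_eq0 => /andP[/eqP-> /eqP->].
  by rewrite num_unit_fubini0.
rewrite -E -(@card_small_rankings 'I_n.+1 n setT) ?cardsT ?card_ord // E.
congr (_ * _); pose f (t : n.+1.-tuple 'I_n.+1) := [ffun i => tnth t i].
have injf : injective f.
  move=> t1 t2 /ffunP eqt; apply: eq_from_tnth => i.
  by have := eqt i; rewrite !ffunE.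
rewrite /num_unit_fubini -[LHS](card_imset _ injf); apply: eq_card => r.
pose t := [tuple r i | i < n.+1].
have -> : r = f t by apply/ffunP=> i; rewrite ffunE tnth_mktuple.
rewrite (mem_imset _ _ injf) inE unit_fubini_rankingE.
have lowE i : [set j in [set: 'I_n.+1] | f t j < f t i] =
              [set j | tnth t j < tnth t i].
  by apply/setP=> j; rewrite !inE !ffunE.
have eqE i : [set j in [set: 'I_n.+1] | f t j == f t i] =
             [set j | tnth t j == tnth t i].
  by apply/setP=> j; rewrite !inE !ffunE.
have -> : num_distinct t = #|f t @: setT|.
  rewrite /num_distinct; congr #|pred_of_set _|; apply/setP=> v.
  by apply/imsetP/imsetP=> -[i _ ->]; exists i; rewrite ?ffunE.
have -> c : (c + k == n.+1) = (c == d) by rewrite -E eqn_add2r.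
apply/andP/small_rankingsP.
  case=> /andP[/fubini_rankingP rk /forallP le2] /eqP dE; split=> // i.
  - by rewrite lowE ffunE -rk.
  - by rewrite eqE.
  - by rewrite !inE.
case=> rk le2 _ ->; split=> //; apply/andP; split.
  by apply/fubini_rankingP=> i; have := rk i (in_setT i); rewrite lowE ffunE.
by apply/forallP=> i; rewrite -eqE le2 // in_setT.
Qed.

(** * Coefficients of the generating function *)

Local Open Scope ring_scope.

Lemma num_unit_fubini_ratio n k :
  (num_unit_fubini n k)%:R / n`!%:R = 'C(n - k, k)%:R / 2 ^+ k :> rat.
Proof.
have two_neq0 : 2 ^+ k != 0 :> rat by rewrite expf_neq0.
have fact_neq0 : n`!%:R != 0 :> rat.
  by rewrite Num.Theory.pnatr_eq0 -lt0n fact_gt0.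
have [lekn|ltnk] := leqP k n; last first.
  (* The inequality [n <= k] unfolds to [n - k == 0], so [eqP] makes it a rewrite rule; then
     ['C(0, k)] is 0 as [k] is positive. *)
  rewrite num_unit_fubini_gt // (eqP (ltnW ltnk)) bin0n.
  by rewrite eqn0Ngt (leq_ltn_trans _ ltnk) // !mul0r.
apply/eqP; rewrite eqr_div // -natrX -!natrM; apply/eqP; congr _%:R.
by have := num_unit_fubiniE (n - k) k; rewrite subnK // => ->; rewrite mulnC.
Qed.

(** The recurrence, up to powers of 2, that the denominator imposes on the coefficients. For [k > n]
    the subtractions truncate and all three terms vanish. *)
Lemma bin_sub_rec n k :
  'C(n.+2 - k.+1, k.+1) = ('C(n.+1 - k.+1, k.+1) + 'C(n - k, k))%N.
Proof.
rewrite !subSS; have [lekn|ltnk] := leqP k n; first by rewrite subSn // binS.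
by rewrite (eqP ltnk) (eqP (ltnW ltnk)) !bin0n; case: k ltnk.
Qed.

Lemma fcoefD (R : comNzRingType) (f g : fps R) n :
  fcoef (f + g) n = fcoef f n + fcoef g n.
Proof. by []. Qed.

Lemma fcoefN (R : comNzRingType) (f : fps R) n : fcoef (- f) n = - fcoef f n.
Proof. by []. Qed.

Lemma fcoefCM (R : comNzRingType) (c : R) (f : fps R) n :
  fcoef (fpsC c * f) n = c * fcoef f n.
Proof.
rewrite /= big_ord_recl /= subn0 big1 ?addr0 // => i _.
by rewrite mul0r.
Qed.

Lemma fcoefXM (R : comNzRingType) (f : fps R) n :
  fcoef (fpsX * f) n = if n is m.+1 then fcoef f m else 0.
Proof.
case: n => [|n] /=; first by rewrite big_ord1 mul0r.
rewrite !big_ord_recl /= mul0r add0r mul1r subn1 big1 ?addr0 // => i _.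
by rewrite mul0r.
Qed.

Lemma fcoef_unit_fubini_gf n k :
  fcoef (fcoef unit_fubini_gf n) k = 'C(n - k, k)%:R / 2 ^+ k.
Proof. exact: num_unit_fubini_ratio. Qed.

(** Identifies the ring inverse of 2, defined by choice, with a constant series whose coefficients
    compute. *)
Lemma fpsC_inv2 : fpsC (fpsC 2^-1) = 2%:R^-1 :> fps (fps rat).
Proof.
apply/esym/mulr1_eq; rewrite mulr_natl mulr2n.
by apply/fpsP=> -[|n]; apply/fpsP=> -[|k] //=; rewrite addr0.
Qed.

Theorem theorem5p4 :
  unit_fubini_gf = 1 / (1 - xvar - qvar / 2%:R * xvar ^+ 2).
Proof.
(* The identity [D * unit_fubini_gf = 1] also proves [D] invertible, which gives the division its
   meaning. *)
set D := 1 - _ - _; suff gfD : D * unit_fubini_gf = 1.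
  have D_unit : D \is a GRing.unit.
    by apply/unitrP; exists unit_fubini_gf; rewrite mulrC.
  by rewrite -gfD mulrAC divrr ?mul1r.
rewrite /D -fpsC_inv2 expr2 !mulrBl mul1r -!mulrA /xvar /qvar.
apply/fpsP=> n; rewrite !fcoefD !fcoefN !fcoefCM !fcoefXM.
apply/fpsP=> k; rewrite !fcoefD !fcoefN.
have zeroE j : fcoef (0 : fps rat) j = 0 by [].
(* The [x] term contributes from [n = 1] on, the [q x^2 / 2] term only for [n >= 2] and [k >= 1]. *)
case: n => [|[|n]]; rewrite !(fcoefXM, mulr0); case: k => [|k];
  rewrite ?fcoefXM ?fcoefCM ?zeroE !fcoef_unit_fubini_gf.
- by [].
- by rewrite sub0n bin0n mul0r !subr0.
- by [].
- by rewrite subSS !sub0n bin0n !mul0r !subr0.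
- by rewrite !bin0 subrr.
(* One Pascal term cancels the [x] contribution; the other, over [2 ^+ k.+1], cancels the
   [q x^2 / 2] one. *)
- rewrite bin_sub_rec natrD mulrDl [X in X - _]addrAC subrr add0r exprS invfM.
  by rewrite [X in X - _]mulrCA subrr.
Qed.
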